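(* Let $\varphi$ be an increasing positive function on $\mathbb R_+$ such that $\lim_{x\to\infty}\varphi(x)=\infty$. There exists a strongly annular function $f$, analytic in the open unit disc $\mathbb D$, whose sequence of Taylor coefficients $\widehat f=(\widehat f(n))_{n\ge0}$ satisfies $\widehat f\in\ell^2_\varphi\setminus\widetilde\ell^{\,2}$.
   Context: A function $f(z)=\sum_{n\ge0}\widehat f(n)z^n$ analytic in $\mathbb D$ is called strongly annular if $\limsup_{r\to1}\min_{|z|=r}|f(z)|=\infty$. Define $$\ell^2_\varphi=\Bigl\{\{a_n\}_{n\ge0}:\ \sum_{n\ge0}\frac{|a_n|^2}{\varphi(1/|a_n|)}<\infty\Bigr\}$$ (terms with $a_n=0$ contribute $0$), and $$\widetilde\ell^{\,2}=\Bigl\{\{a_n\}_{n\ge0}:\ \sum_{k\ge0}\min\left(|a_{2k}|^2,|a_{2k+1}|^2\right)<\infty\Bigr\}.$$ *)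

(* Defs.v *)
(* Stdlib reals with Coquelicot's complex numbers. *)
From Stdlib Require Export Reals.
From Coquelicot Require Export Coquelicot.
Open Scope R_scope.

(* [f] is analytic in the open unit disc with Taylor coefficients [a] at 0.
   Values of the total function [f] outside the disc are irrelevant. *)
Definition taylor_on_disc (f : C -> C) (a : nat -> C) : Prop :=
  forall z : C, Cmod z < 1 -> is_pseries a z (f z).

(* Upper limit of [g] along [F]: the infimum of [sup_P g] over all [P] in [F].
   Coquelicot only provides it for sequences ([LimSup_seq]). *)
Definition LimSup (F : (R -> Prop) -> Prop) (g : R -> R) : Rbar :=
  Rbar_glb (fun s : Rbar =>
    exists P : R -> Prop,
      F P /\ s = Lub_Rbar (fun y : R => exists x : R, P x /\ y = g x)).

Definition is_min_on (D : C -> Prop) (h : C -> R) (m : R) : Prop :=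
  (exists z : C, D z /\ h z = m) /\ (forall z : C, D z -> m <= h z).

(* [m] is determined by [f] on (0, 1), hence near 1 on the left. *)
Definition strongly_annular (f : C -> C) : Prop :=
  exists m : R -> R,
    (forall r : R, 0 < r < 1 ->
      is_min_on (fun z : C => Cmod z = r) (fun z : C => Cmod (f z)) (m r)) /\
    LimSup (at_left 1) m = p_infty.

Definition ell2_phi_term (phi : R -> R) (c : C) : R :=
  if Req_EM_T (Cmod c) 0 then 0 else Cmod c ^ 2 / phi (/ Cmod c).

(* All terms of the two series below are nonnegative (for positive [phi]), so
   [ex_series] expresses the finiteness of the sum. *)
Definition ell2_phi (phi : R -> R) (a : nat -> C) : Prop :=
  ex_series (fun n : nat => ell2_phi_term phi (a n)).

Definition ell2_tilde (a : nat -> C) : Prop :=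
  ex_series (fun k : nat =>
    Rmin (Cmod (a (2 * k)%nat) ^ 2) (Cmod (a (2 * k + 1)%nat) ^ 2)).

(* Main.v *)
Require Import Defs.
From Stdlib Require Import Reals Lra Lia List IndefiniteDescription.
From Coquelicot Require Import Coquelicot.
Import ListNotations.
Open Scope R_scope.

(** Everything rests on polynomials that are bounded below on the unit circle,
    bounded in quadratic mean, and have arbitrarily small coefficients
    ([flat_polynomial]).  If [P] is such a polynomial, with [|P| >= 1] on the
    circle, [sum |p_n|^2 <= 9] and [|p_n| <= eps], then a large multiple [A P] is
    at least [A] on the circle, while its weighted sum of squares is at most
    [9 A^2 / phi (1 / (A eps))], which is as small as desired once [eps] is small
    enough in terms of [A], because [phi] tends to infinity.

    Such polynomials come from a Riesz product.  The function [exp (2 i d cos t)]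
    is unimodular and its Taylor polynomial of order 2 in [d],
    [1 + i d c - d^2 c^2 / 2] with [c = 2 cos t], still has modulus at least 1,
    since [|.|^2 = 1 + d^4 c^4 / 4].  Multiplied by [z^2], it is a polynomial of
    degree 4 in [z = e^{it}] whose coefficients, if [0 <= d <= 1/2], have modulus
    at most [1 - d^2], and whose sum of squares is [1 + 3/2 d^4].  Multiplying [n]
    copies taken at [z, z^5, z^25, ...], where no two products of monomials coincide, gives
    coefficients at most [(1 - d^2)^n] and sum of squares [(1 + 3/2 d^4)^n].
    The gain is of second order in [d] and the loss of fourth order: with
    [d = 1/m] and [n = m^4] the first quantity is below [exp (- m^2)] and the
    second one stays below [exp (3/2)].

    The blocks [A_k P_k] are then concatenated into one sequence [b]
    ([next_block], [block_sequence]): [A_k] is chosen to dominate the part of the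
    sequence already built, a radius [r_k] close to 1 is chosen by uniform
    continuity, and the block is padded with zeros so that all later terms are
    negligible on the circle of radius [r_k].  Finally
    [f(z) = (2 + z) g(z^2)], where [g] has coefficients [b]: its coefficients
    are [2 b_n] and [b_n] at the places [2n] and [2n + 1], so that the smaller
    one has square modulus [|b_n|^2], whose sum diverges because every block
    contributes at least 1; and [|f(z)| >= |g(z^2)|] in the disc. *)

(** * Polynomials as coefficient lists *)
Definition lsum (h : C -> R) (l : list C) : R :=
  fold_right (fun x s => h x + s) 0 l.

Fixpoint peval (l : list C) (z : C) : C :=
  match l with
  | nil => 0
  | x :: t => x + z * peval t z
  end.

(** A Lipschitz constant of [peval l] on the closed unit disc, namely
    [sum n |l_n|] written so that it follows the recursion of [peval]. *)
Fixpoint lip_const (l : list C) : R :=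
  match l with
  | nil => 0
  | x :: t => lsum Cmod t + lip_const t
  end.

(** The coefficients of [D(z^|l|) * l(z)]: since [l] has degree less than [|l|],
    the translates of [l] do not overlap and every coefficient is a single
    product [d * x].  This is what makes all norms below multiplicative. *)
Definition tensor (D l : list C) : list C :=
  flat_map (fun d => map (Cmult d) l) D.

Lemma lsum_app (h : C -> R) (l l' : list C) :
  lsum h (l ++ l') = lsum h l + lsum h l'.
Proof. induction l as [|x l IH]; simpl; [|rewrite IH]; lra. Qed.

Lemma lsum_map_scal (h : C -> R) (g : C -> C) (c : R) (l : list C) :
  (forall x, h (g x) = c * h x) -> lsum h (map g l) = c * lsum h l.
Proof.
  intros H; induction l as [|x l IH]; simpl; [|rewrite IH, H]; lra.
Qed.

Lemma lsum_le (h k : C -> R) (l : list C) :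
  (forall x, In x l -> h x <= k x) -> lsum h l <= lsum k l.
Proof.
  induction l as [|x l IH]; simpl; intros H; [lra|].
  apply Rplus_le_compat; auto.
Qed.

Lemma lsum_ge0 (h : C -> R) (l : list C) :
  (forall x, 0 <= h x) -> 0 <= lsum h l.
Proof.
  intros H; induction l as [|x l IH]; simpl; [lra|].
  specialize (H x); lra.
Qed.

Lemma lsum_zeros (h : C -> R) (m : nat) :
  h 0%C = 0 -> lsum h (repeat (RtoC 0) m) = 0.
Proof. intros H; induction m; simpl; [|rewrite H]; lra. Qed.

Lemma peval_app (l l' : list C) (z : C) :
  peval (l ++ l') z = (peval l z + z ^ length l * peval l' z)%C.
Proof. induction l as [|x l IH]; simpl; [|rewrite IH]; ring. Qed.

Lemma peval_scal (d : C) (l : list C) (z : C) :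
  peval (map (Cmult d) l) z = (d * peval l z)%C.
Proof. induction l as [|x l IH]; simpl; [|rewrite IH]; ring. Qed.

Lemma peval_zeros (m : nat) (z : C) : peval (repeat (RtoC 0) m) z = 0%C.
Proof. induction m; simpl; [|rewrite IHm]; ring. Qed.

Lemma peval_tensor (D l : list C) (z : C) :
  peval (tensor D l) z = (peval D (z ^ length l) * peval l z)%C.
Proof.
  induction D as [|d D IH]; simpl; [ring|].
  fold (tensor D l).
  rewrite peval_app, IH, peval_scal, length_map; ring.
Qed.

Lemma lsum_sq_tensor (D l : list C) :
  lsum (fun x => Cmod x ^ 2) (tensor D l) =
  lsum (fun x => Cmod x ^ 2) D * lsum (fun x => Cmod x ^ 2) l.
Proof.
  induction D as [|d D IH]; [simpl; ring|].
  change (tensor (d :: D) l) with (map (Cmult d) l ++ tensor D l).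
  rewrite lsum_app, IH, (lsum_map_scal _ _ (Cmod d ^ 2)); [simpl; ring|].
  intros x; rewrite Cmod_mult; ring.
Qed.

Lemma Cmod_tensor_le (p q : R) (D l : list C) :
  0 <= p ->
  (forall x, In x D -> Cmod x <= p) -> (forall x, In x l -> Cmod x <= q) ->
  forall x, In x (tensor D l) -> Cmod x <= p * q.
Proof.
  intros Hp HD Hl x Hx.
  apply in_flat_map in Hx; destruct Hx as [d [Hd Hx]].
  apply in_map_iff in Hx; destruct Hx as [y [<- Hy]].
  rewrite Cmod_mult.
  apply Rmult_le_compat; auto using Cmod_ge_0.
Qed.

Lemma Cmod_peval_le (l : list C) (z : C) :
  Cmod z <= 1 -> Cmod (peval l z) <= lsum Cmod l.
Proof.
  intros Hz; induction l as [|x l IH]; simpl; [rewrite Cmod_0; lra|].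
  eapply Rle_trans; [apply Cmod_triangle|].
  rewrite Cmod_mult.
  assert (H := Cmod_ge_0 z); assert (H' := Cmod_ge_0 (peval l z)).
  nra.
Qed.

Lemma lip_const_ge0 (l : list C) : 0 <= lip_const l.
Proof.
  induction l as [|x l IH]; simpl; [lra|].
  assert (H := lsum_ge0 Cmod l Cmod_ge_0); lra.
Qed.

Lemma peval_lipschitz (l : list C) (z w : C) :
  Cmod z <= 1 -> Cmod w <= 1 ->
  Cmod (peval l z - peval l w) <= lip_const l * Cmod (z - w).
Proof.
  intros Hz Hw; induction l as [|x l IH]; simpl.
  { replace (0 - 0)%C with (RtoC 0) by ring. rewrite Cmod_0; lra. }
  replace (x + z * peval l z - (x + w * peval l w))%C
    with ((z - w) * peval l z + w * (peval l z - peval l w))%C by ring.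
  eapply Rle_trans; [apply Cmod_triangle|].
  rewrite !Cmod_mult.
  assert (H1 := Cmod_peval_le l z Hz).
  assert (H2 := Cmod_ge_0 (z - w)).
  assert (H3 := Cmod_ge_0 (peval l z - peval l w)).
  assert (H4 := Cmod_ge_0 w).
  nra.
Qed.

Lemma Cmod_ge_sub (x y : C) : Cmod x - Cmod y <= Cmod (x - y).
Proof.
  assert (H := Cmod_triangle (x - y) y).
  replace (x - y + y)%C with x in H by ring. lra.
Qed.

Lemma Cmod_sub_sym (x y : C) : Cmod (x - y) = Cmod (y - x).
Proof. rewrite <- Cmod_opp; f_equal; ring. Qed.

(** * Flat polynomials with small coefficients *)

(** [z^2 * (1 + u + u^2 / 2)] with [u = i d (z + 1/z)]; on the unit circle, [u] is
    the purely imaginary number [2 i d cos t]. *)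
Definition exp_taylor2 (d : R) : list C :=
  [RtoC (- d ^ 2 / 2); (RtoC d * Ci)%C; RtoC (1 - d ^ 2); (RtoC d * Ci)%C;
   RtoC (- d ^ 2 / 2)].

(** On the circle, [1 + u + u^2 / 2 = (1 - d^2 c^2 / 2) + i d c] with
    [c = 2 Re z], and the terms of order 2 cancel in the square of its modulus,
    which is [1 + d^4 c^4 / 4]. *)
Lemma exp_taylor2_ge1 (d : R) (z : C) :
  Cmod z = 1 -> 1 <= Cmod (peval (exp_taylor2 d) z).
Proof.
  intros Hz.
  assert (Hc : (z * Cconj z)%C = 1%C).
  { rewrite <- Cmod2_conj, Hz. f_equal; ring. }
  assert (Hx : (z + Cconj z)%C = RtoC (2 * Re z)).
  { destruct z as [x y]; unfold Cconj, Re, Cplus, RtoC; simpl; f_equal; ring. }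
  set (c := 2 * Re z) in *.
  assert (E : peval (exp_taylor2 d) z
              = (z ^ 2 * (1 - d ^ 2 * c ^ 2 / 2, d * c)%R)%C).
  { replace ((1 - d ^ 2 * c ^ 2 / 2, d * c)%R : C)
      with (1 + RtoC d * Ci * RtoC c + RtoC (-1/2) * RtoC d ^ 2 * RtoC c ^ 2)%C.
    2:{ rewrite <- !RtoC_pow. unfold Cplus, Cmult, RtoC, Ci; simpl; f_equal; field. }
    rewrite <- Hx.
    unfold exp_taylor2; cbn [peval].
    replace (RtoC (- d ^ 2 / 2)) with (RtoC (-1/2) * RtoC d ^ 2)%C.
    2:{ rewrite <- RtoC_pow, <- RtoC_mult. f_equal; field. }
    replace (RtoC (1 - d ^ 2)) with (1 + RtoC (-1/2) * RtoC d ^ 2 * 2)%C.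
    2:{ rewrite <- RtoC_pow, <- !RtoC_mult, <- RtoC_plus. f_equal; field. }
    set (D := RtoC d); set (h := RtoC (-1/2)); set (w := Cconj z) in *.
    (* polynomial identity in [z] and [w], with the multiple of [z w - 1] that
       vanishes on the circle made explicit *)
    transitivity (z ^ 2 * (1 + D * Ci * (z + w) + h * D ^ 2 * (z + w) ^ 2)
      - (z * w - 1) * (D * Ci * z + h * D ^ 2 * (2 * z ^ 2 + z * w + 1)))%C.
    - ring.
    - rewrite Hc; ring. }
  rewrite E, Cmod_mult, Cmod_pow, Hz, pow1, Rmult_1_l.
  unfold Cmod; simpl fst; simpl snd.
  rewrite <- sqrt_1 at 1.
  apply sqrt_le_1_alt.
  assert (H := pow2_ge_0 (d ^ 2 * c ^ 2)). nra.
Qed.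

Lemma Cmod_iR (d : R) : 0 <= d -> Cmod (RtoC d * Ci) = d.
Proof. intros; rewrite Cmod_mult, Cmod_Ci, Cmod_R, Rabs_pos_eq; lra. Qed.

Lemma exp_taylor2_sq (d : R) :
  lsum (fun x => Cmod x ^ 2) (exp_taylor2 d) = 1 + 3 / 2 * d ^ 4.
Proof.
  unfold exp_taylor2, lsum; cbn [fold_right].
  rewrite !Cmod_mult, Cmod_Ci, !Cmod_R.
  rewrite !Rpow_mult_distr, !pow2_abs. field.
Qed.

Lemma exp_taylor2_le (d : R) (x : C) :
  0 <= d <= 1 / 2 -> In x (exp_taylor2 d) -> Cmod x <= 1 - d ^ 2.
Proof.
  intros Hd Hx.
  repeat destruct Hx as [<-|Hx]; try contradiction;
    rewrite ?Cmod_iR, ?Cmod_R by lra; try apply Rabs_le; nra.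
Qed.

(** The product of [exp_taylor2 d] at [z, z^5, ..., z^(5^(n-1))]. *)
Fixpoint riesz_product (d : R) (n : nat) : list C :=
  match n with
  | O => [RtoC 1]
  | S n => tensor (exp_taylor2 d) (riesz_product d n)
  end.

Lemma riesz_product_ge1 (d : R) (n : nat) (z : C) :
  Cmod z = 1 -> 1 <= Cmod (peval (riesz_product d n) z).
Proof.
  intros Hz; induction n as [|n IH].
  - simpl. replace (1 + z * 0)%C with (RtoC 1) by ring. rewrite Cmod_1; lra.
  - cbn [riesz_product]. rewrite peval_tensor, Cmod_mult.
    assert (H : 1 <= Cmod (peval (exp_taylor2 d) (z ^ length (riesz_product d n)))).
    { apply exp_taylor2_ge1. rewrite Cmod_pow, Hz. apply pow1. }
    nra.
Qed.

Lemma riesz_product_sq (d : R) (n : nat) :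
  lsum (fun x => Cmod x ^ 2) (riesz_product d n) = (1 + 3 / 2 * d ^ 4) ^ n.
Proof.
  induction n as [|n IH].
  - simpl. rewrite Cmod_1; ring.
  - cbn [riesz_product]. rewrite lsum_sq_tensor, exp_taylor2_sq, IH. reflexivity.
Qed.

Lemma riesz_product_le (d : R) (n : nat) :
  0 <= d <= 1 / 2 ->
  forall x, In x (riesz_product d n) -> Cmod x <= (1 - d ^ 2) ^ n.
Proof.
  intros Hd; induction n as [|n IH].
  - intros x [<-|[]]. rewrite Cmod_1; simpl; lra.
  - apply Cmod_tensor_le; [nra| |exact IH].
    intros x; apply exp_taylor2_le; exact Hd.
Qed.

Lemma pow_exp (x : R) (n : nat) : exp x ^ n = exp (INR n * x).
Proof.
  induction n as [|n IH]; [rewrite Rmult_0_l, exp_0; reflexivity|].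
  rewrite S_INR; simpl pow; rewrite IH, <- exp_plus; f_equal; ring.
Qed.

Lemma pow_le_exp (x : R) (n : nat) : 0 <= 1 + x -> (1 + x) ^ n <= exp (INR n * x).
Proof.
  intros H. rewrite <- pow_exp.
  apply pow_incr; split; [exact H|apply exp_ineq1_le].
Qed.

(** With [d = 1/m] and [m^4] factors, the coefficients are at most
    [exp (- d^2 m^4) = exp (- m^2)], while the sum of squares is at most
    [exp (3/2 d^4 m^4) = exp (3/2) <= 9]: only the existence of a bound that does
    not depend on [eps] matters. *)
Lemma flat_polynomial (eps : R) :
  0 < eps ->
  exists l : list C,
    (forall x, In x l -> Cmod x <= eps) /\
    1 <= lsum (fun x => Cmod x ^ 2) l <= 9 /\
    (forall z, Cmod z = 1 -> 1 <= Cmod (peval l z)).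
Proof.
  intros He.
  destruct (archimed_cor1 (Rmin eps (1 / 2))) as [m [Hm Hm0]].
  { apply Rmin_glb_lt; lra. }
  assert (M0 : 0 < INR m) by (apply lt_0_INR; exact Hm0).
  assert (Hd0 : 0 < / INR m) by (apply Rinv_0_lt_compat; exact M0).
  assert (Hd1 := Rmin_l eps (1 / 2)); assert (Hd2 := Rmin_r eps (1 / 2)).
  set (d := / INR m) in *.
  exists (riesz_product d (m ^ 4)).
  assert (Hn : INR (m ^ 4) * d ^ 4 = 1).
  { rewrite pow_INR; unfold d; field; lra. }
  assert (Hn2 : INR (m ^ 4) * d ^ 2 = INR m ^ 2).
  { rewrite pow_INR; unfold d; field; lra. }
  split; [|split; [split|]].
  - intros x Hx.
    eapply Rle_trans; [apply (riesz_product_le d (m ^ 4)); [lra|exact Hx]|].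
    replace (1 - d ^ 2) with (1 + - d ^ 2) by ring.
    eapply Rle_trans; [apply pow_le_exp; nra|].
    replace (INR (m ^ 4) * - d ^ 2) with (- INR m ^ 2) by nra.
    rewrite exp_Ropp.
    assert (HM : INR m <= exp (INR m ^ 2)).
    { assert (H := exp_ineq1_le (INR m ^ 2)). nra. }
    apply Rle_trans with d; [|lra].
    apply Rinv_le_contravar; assumption.
  - rewrite riesz_product_sq. apply pow_R1_Rle.
    assert (H := pow2_ge_0 (d ^ 2)). nra.
  - rewrite riesz_product_sq.
    eapply Rle_trans; [apply pow_le_exp|].
    { assert (H := pow2_ge_0 (d ^ 2)). nra. }
    replace (INR (m ^ 4) * (3 / 2 * d ^ 4)) with (3 / 2) by nra.
    apply Rle_trans with (exp 2).
    { left; apply exp_increasing; lra. }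
    replace 2 with (1 + 1) by ring. rewrite exp_plus.
    assert (H := exp_le_3). assert (H' := exp_pos 1). nra.
  - intros z; apply riesz_product_ge1.
Qed.

(** * Appending one block *)
Lemma ell2_phi_term_ge0 (phi : R -> R) (c : C) :
  (forall x, 0 < x -> 0 < phi x) -> 0 <= ell2_phi_term phi c.
Proof.
  intros phi_pos; unfold ell2_phi_term.
  destruct (Req_EM_T (Cmod c) 0) as [H|H]; [lra|].
  apply Rdiv_le_0_compat; [apply pow2_ge_0|].
  apply phi_pos, Rinv_0_lt_compat.
  assert (H' := Cmod_ge_0 c); lra.
Qed.

Lemma ell2_phi_term_le (phi : R -> R) (c : C) (e P : R) :
  (forall x y, 0 < x -> x <= y -> phi x <= phi y) ->
  0 < P -> Cmod c <= e -> P <= phi (/ e) ->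
  ell2_phi_term phi c <= Cmod c ^ 2 / P.
Proof.
  intros phi_incr HP Hc He; unfold ell2_phi_term.
  assert (H0 := Cmod_ge_0 c).
  destruct (Req_EM_T (Cmod c) 0) as [H|H].
  { apply Rdiv_le_0_compat; [apply pow2_ge_0|exact HP]. }
  apply Rmult_le_compat_l; [apply pow2_ge_0|].
  apply Rinv_le_contravar; [exact HP|].
  apply Rle_trans with (1 := He), phi_incr.
  - apply Rinv_0_lt_compat; lra.
  - apply Rinv_le_contravar; lra.
Qed.

Lemma ell2_phi_term_mono (phi : R -> R) (c d : C) :
  (forall x y, 0 < x -> x <= y -> phi x <= phi y) ->
  (forall x, 0 < x -> 0 < phi x) ->
  Cmod c <= Cmod d -> ell2_phi_term phi c <= ell2_phi_term phi d.
Proof.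
  intros phi_incr phi_pos H.
  assert (H0 := Cmod_ge_0 c).
  destruct (Req_EM_T (Cmod d) 0) as [Hd|Hd].
  { unfold ell2_phi_term at 1.
    destruct (Req_EM_T (Cmod c) 0) as [Hc|Hc]; [|lra].
    apply ell2_phi_term_ge0, phi_pos. }
  assert (HP : 0 < phi (/ Cmod d)).
  { apply phi_pos, Rinv_0_lt_compat; lra. }
  eapply Rle_trans.
  { apply (ell2_phi_term_le phi c (Cmod d)); [exact phi_incr|exact HP|exact H|lra]. }
  unfold ell2_phi_term.
  destruct (Req_EM_T (Cmod d) 0) as [Hd'|_]; [lra|].
  apply Rmult_le_compat_r; [left; apply Rinv_0_lt_compat, HP|].
  apply pow_incr; lra.
Qed.

(** Radial transfer of a lower bound: [w] is compared with [w / |w|], at distance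
    [1 - r]. *)
Lemma peval_lower_inside (l : list C) (K r : R) (w : C) :
  (forall z, Cmod z = 1 -> K <= Cmod (peval l z)) ->
  0 < r <= 1 -> Cmod w = r ->
  K - lip_const l * (1 - r) <= Cmod (peval l w).
Proof.
  intros HK Hr Hw.
  assert (Hr0 : RtoC r <> 0%C) by (intros E; apply RtoC_inj in E; lra).
  assert (Hz : Cmod (w / RtoC r) = 1).
  { rewrite Cmod_div, Hw, Cmod_R, Rabs_pos_eq by (assumption || lra). field; lra. }
  set (z := (w / RtoC r)%C) in *.
  assert (Hd : Cmod (z - w) = 1 - r).
  { replace (z - w)%C with (z * RtoC (1 - r))%C.
    2:{ rewrite RtoC_minus; unfold z; field; exact Hr0. }
    rewrite Cmod_mult, Hz, Cmod_R, Rabs_pos_eq; lra. }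
  assert (H1 := HK z Hz).
  assert (H2 : Cmod (peval l z - peval l w) <= lip_const l * Cmod (z - w)).
  { apply peval_lipschitz; [rewrite Hz|rewrite Hw]; lra. }
  assert (H3 := Cmod_ge_sub (peval l z) (peval l w)).
  rewrite Hd in H2; lra.
Qed.

(** Prolongs a polynomial [l] so that the result exceeds [k + 1] on some circle
    close to the unit one.  The new block is [A P] with [P] flat and [A]
    dominating [sum |l_n|] by [k + 2]; one unit is lost when moving from the unit
    circle to the circle of radius [r^2].  The trailing zeros give the last
    inequality: since the final coefficients are bounded by 1, it says that
    everything beyond [l ++ t] will contribute at most 1 on [|z| = r].  The radius
    is [r^2] here, and the exponent is doubled, because the polynomial will be
    evaluated at [z^2]; likewise [2 * x] is the largest coefficient that an entry
    [x] will produce. *)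
Lemma next_block (phi : R -> R)
  (phi_incr : forall x y : R, 0 < x -> x <= y -> phi x <= phi y)
  (phi_lim : is_lim phi p_infty p_infty) (l : list C) (k : nat) :
  exists (t : list C) (r : R),
    (forall x, In x t -> Cmod x <= 1 / 2) /\
    lsum (fun x => ell2_phi_term phi (2 * x)) t <= (1 / 2) ^ k /\
    1 <= lsum (fun x => Cmod x ^ 2) t /\
    1 - / (INR k + 1) < r < 1 /\
    (forall w, Cmod w = r ^ 2 -> INR k + 1 <= Cmod (peval (l ++ t) w)) /\
    r ^ (2 * length (l ++ t)) <= 1 - r.
Proof.
  set (M := lsum Cmod l).
  assert (HM : 0 <= M) by (apply lsum_ge0, Cmod_ge_0).
  assert (Hk := pos_INR k).
  set (A := INR k + 2 + M).
  assert (HA : 2 <= A) by (unfold A; lra).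
  assert (H2k : 0 < (1 / 2) ^ k) by (apply pow_lt; lra).
  set (P := 36 * A ^ 2 / (1 / 2) ^ k).
  assert (HP : 0 < P) by (apply Rdiv_lt_0_compat; nra).
  (* for coefficients of modulus at most [e], [phi] is evaluated beyond [1 / e],
     hence is at least [P] *)
  assert (He : exists e, 0 < e <= 1 /\ P <= phi (/ e)).
  { apply is_lim_spec in phi_lim. destruct (phi_lim P) as [X HX].
    assert (H1 := Rmax_l 1 (X + 1)). assert (H2 := Rmax_r 1 (X + 1)).
    exists (/ Rmax 1 (X + 1)).
    rewrite Rinv_inv. split; [split|].
    - apply Rinv_0_lt_compat; lra.
    - apply Rle_trans with (/ 1); [apply Rinv_le_contravar; lra|rewrite Rinv_1; lra].
    - left; apply HX; lra. }
  destruct He as [e [He HPe]].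
  destruct (flat_polynomial (e / (2 * A))) as [p [Hp [Hsq Hflat]]].
  { apply Rdiv_lt_0_compat; lra. }
  set (t0 := map (Cmult (RtoC A)) p).
  assert (HA' : Cmod (RtoC A) = A) by (rewrite Cmod_R, Rabs_pos_eq; lra).
  assert (Ht0 : forall x, In x t0 -> Cmod (2 * x) <= e).
  { intros x Hx. apply in_map_iff in Hx; destruct Hx as [y [<- Hy]].
    rewrite !Cmod_mult, HA', Cmod_R, Rabs_pos_eq by lra.
    specialize (Hp y Hy).
    replace e with (2 * (A * (e / (2 * A)))) by (field; lra).
    nra. }
  assert (Hsq0 : lsum (fun x => Cmod x ^ 2) t0
                 = A ^ 2 * lsum (fun x => Cmod x ^ 2) p).
  { apply lsum_map_scal. intros x; rewrite Cmod_mult, HA'; ring. }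
  set (L := lip_const (l ++ t0)).
  assert (HL : 0 <= L) by apply lip_const_ge0.
  assert (Hden : 0 < INR k + 2 + 2 * L) by lra.
  (* makes [(1 - r^2) L <= 1], besides [1 - r < 1 / (k + 1)] *)
  set (r := 1 - / (INR k + 2 + 2 * L)).
  assert (Hr1 : 0 < 1 - r).
  { unfold r; ring_simplify; apply Rinv_0_lt_compat; lra. }
  assert (Hr2 : (1 - r) * (INR k + 2 + 2 * L) = 1).
  { unfold r; field; lra. }
  assert (Hr3 : 1 / 2 <= r) by nra.
  destruct (pow_lt_1_zero r ltac:(rewrite Rabs_pos_eq; lra) (1 - r) Hr1)
    as [m Hm].
  exists (t0 ++ repeat (RtoC 0) m), r.
  split; [|split; [|split; [|split; [|split]]]].
  - intros x Hx; apply in_app_or in Hx; destruct Hx as [Hx|Hx].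
    + specialize (Ht0 x Hx).
      rewrite Cmod_mult, Cmod_R, Rabs_pos_eq in Ht0 by lra. lra.
    + apply repeat_spec in Hx; subst x. rewrite Cmod_0; lra.
  - rewrite lsum_app, lsum_zeros.
    2:{ unfold ell2_phi_term. rewrite Cmult_0_r, Cmod_0.
        destruct (Req_EM_T 0 0); lra. }
    rewrite Rplus_0_r.
    eapply Rle_trans.
    { apply (lsum_le _ (fun x => Cmod (2 * x) ^ 2 / P)).
      intros x Hx.
      apply (ell2_phi_term_le phi (2 * x) e); auto. }
    unfold t0.
    rewrite (lsum_map_scal (fun x => Cmod (2 * x) ^ 2 / P) _ (A ^ 2)).
    2:{ intros x. rewrite !Cmod_mult, HA'. field; lra. }
    apply Rle_trans with (A ^ 2 * (4 / P * lsum (fun x => Cmod x ^ 2) p)).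
    { apply Req_le. f_equal. clear. unfold lsum.
      induction p as [|x p IH]; cbn [fold_right]; [ring|].
      rewrite IH, Cmod_mult, Cmod_R, Rabs_pos_eq by lra. unfold Rdiv; ring. }
    apply Rle_trans with (A ^ 2 * (4 / P * 9)).
    { apply Rmult_le_compat_l; [nra|]. apply Rmult_le_compat_l; [|lra].
      left; apply Rdiv_lt_0_compat; lra. }
    apply Req_le. unfold P. field. split; [apply pow_nonzero|]; lra.
  - rewrite lsum_app, lsum_zeros by (rewrite Cmod_0; ring).
    rewrite Hsq0. nra.
  - split; [|lra].
    apply Rplus_lt_compat_l, Ropp_lt_contravar.
    apply Rinv_lt_contravar; nra.
  - intros w Hw.
    rewrite app_assoc, peval_app, peval_zeros, Cmult_0_r, Cplus_0_r.
    assert (HK : forall z, Cmod z = 1 -> A - M <= Cmod (peval (l ++ t0) z)).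
    { intros z Hz. rewrite peval_app. unfold t0; rewrite peval_scal.
      assert (H1 := Cmod_peval_le l z (Req_le _ _ Hz)). fold M in H1.
      assert (H2 := Hflat z Hz).
      assert (H3 := Cmod_ge_sub (z ^ length l * (RtoC A * peval p z)) (- peval l z)).
      rewrite Cmod_opp, !Cmod_mult, Cmod_pow, Hz, pow1, HA' in H3.
      replace (peval l z + z ^ length l * (RtoC A * peval p z))%C with
        (z ^ length l * (RtoC A * peval p z) - - peval l z)%C by ring.
      nra. }
    assert (H := peval_lower_inside (l ++ t0) (A - M) (r ^ 2) w HK ltac:(nra) Hw).
    fold L in H.
    assert (HLr : L * (1 - r ^ 2) <= 1).
    { assert (0 <= L * (1 - r) * (1 - r)) by (apply Rmult_le_pos; nra).
      assert (0 <= (1 - r) * (INR k + 2)) by nra. nra. }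
    unfold A in H. lra.
  - specialize (Hm (2 * length (l ++ t0 ++ repeat (RtoC 0) m))%nat).
    rewrite Rabs_pos_eq in Hm by (apply pow_le; lra).
    left; apply Hm. rewrite !length_app, repeat_length. lia.
Qed.

Lemma prefix_limit (L : nat -> list C) :
  (forall k, exists t, t <> nil /\ L (S k) = L k ++ t) ->
  exists b : nat -> C,
    forall k, (k <= length (L k))%nat /\ map b (seq 0 (length (L k))) = L k.
Proof.
  intros HL.
  assert (Hlen : forall k, (k <= length (L k))%nat).
  { induction k as [|k IH]; [lia|].
    destruct (HL k) as [t [Ht ->]]. rewrite length_app.
    destruct t; [congruence|simpl; lia]. }
  assert (Hpre : forall k j, exists t, L (k + j)%nat = L k ++ t).
  { intros k; induction j as [|j [t IH]].
    - exists nil. rewrite Nat.add_0_r, app_nil_r; reflexivity.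
    - rewrite Nat.add_succ_r. destruct (HL (k + j)%nat) as [u [_ ->]].
      rewrite IH. exists (t ++ u). rewrite app_assoc; reflexivity. }
  assert (Hnth : forall k k' n, (n < length (L k))%nat -> (k <= k')%nat ->
    nth n (L k') (RtoC 0) = nth n (L k) (RtoC 0)).
  { intros k k' n Hn Hk. destruct (Hpre k (k' - k)%nat) as [t Ht].
    replace (k + (k' - k))%nat with k' in Ht by lia.
    rewrite Ht, app_nth1; auto. }
  exists (fun n => nth n (L (S n)) (RtoC 0)).
  intros k; split; [apply Hlen|].
  apply (nth_ext _ _ (RtoC 0) (RtoC 0)); rewrite length_map, length_seq; [reflexivity|].
  intros n Hn.
  rewrite (nth_indep _ _ (nth 0 (L 1%nat) (RtoC 0)))
    by (rewrite length_map, length_seq; exact Hn).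
  rewrite (map_nth (fun n => nth n (L (S n)) (RtoC 0)) _ 0%nat).
  rewrite seq_nth, Nat.add_0_l by exact Hn.
  destruct (Nat.le_ge_cases (S n) k) as [H|H].
  - symmetry; apply Hnth; [|exact H]. specialize (Hlen (S n)); lia.
  - apply Hnth; assumption.
Qed.

(** * Power series with coefficients bounded by 1 *)
Definition trunc (a : nat -> C) (N : nat) : list C := map a (seq 0 N).

Lemma trunc_S (a : nat -> C) (N : nat) : trunc a (S N) = trunc a N ++ [a N].
Proof. unfold trunc; rewrite seq_S, map_app; reflexivity. Qed.

Lemma length_trunc (a : nat -> C) (N : nat) : length (trunc a N) = N.
Proof. unfold trunc; rewrite length_map, length_seq; reflexivity. Qed.

Lemma peval_trunc_S (a : nat -> C) (N : nat) (z : C) :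
  peval (trunc a (S N)) z = (peval (trunc a N) z + z ^ N * a N)%C.
Proof. rewrite trunc_S, peval_app, length_trunc; simpl; ring. Qed.

Lemma sum_n_peval (a : nat -> C) (N : nat) (z : C) :
  sum_n (fun n => scal (pow_n z n) (a n)) N = peval (trunc a (S N)) z.
Proof.
  assert (Hp : forall n, pow_n z n = (z ^ n)%C).
  { induction n as [|n IH]; [reflexivity|]. simpl; rewrite <- IH; reflexivity. }
  induction N as [|N IH].
  - rewrite sum_O. simpl. change (scal one (a O)) with (1 * a O)%C. ring.
  - rewrite sum_Sn, IH, (peval_trunc_S a (S N)), Hp. reflexivity.
Qed.

(** The right-hand side is the geometric sum of [|z|^n] over [N <= n < N + m]. *)
Lemma peval_trunc_tail (a : nat -> C) (N m : nat) (z : C) :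
  (forall n, Cmod (a n) <= 1) -> Cmod z < 1 ->
  Cmod (peval (trunc a (N + m)) z - peval (trunc a N) z)
  <= (Cmod z ^ N - Cmod z ^ (N + m)) / (1 - Cmod z).
Proof.
  intros Ha Hz; assert (Hz0 := Cmod_ge_0 z).
  induction m as [|m IH].
  - rewrite Nat.add_0_r.
    replace (peval (trunc a N) z - peval (trunc a N) z)%C with (RtoC 0) by ring.
    rewrite Cmod_0. apply Req_le. field. lra.
  - rewrite Nat.add_succ_r, peval_trunc_S.
    replace (peval (trunc a (N + m)) z + z ^ (N + m) * a (N + m)%nat
      - peval (trunc a N) z)%C
      with (peval (trunc a (N + m)) z - peval (trunc a N) z
            + z ^ (N + m) * a (N + m)%nat)%C by ring.
    eapply Rle_trans; [apply Cmod_triangle|].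
    rewrite Cmod_mult, Cmod_pow.
    assert (H := Ha (N + m)%nat).
    assert (H' : 0 <= Cmod z ^ (N + m)) by (apply pow_le; exact Hz0).
    apply Rle_trans with ((Cmod z ^ N - Cmod z ^ (N + m)) / (1 - Cmod z)
      + Cmod z ^ (N + m)); [nra|].
    apply Req_le; simpl pow. field. lra.
Qed.

Lemma taylor_bounded (a : nat -> C) :
  (forall n, Cmod (a n) <= 1) ->
  exists f : C -> C,
    taylor_on_disc f a /\
    forall z N, Cmod z < 1 ->
      Cmod (f z - peval (trunc a N) z) <= Cmod z ^ N / (1 - Cmod z).
Proof.
  intros Ha.
  assert (Hex : forall z, exists v : C, Cmod z < 1 -> is_pseries a z v).
  { intros z. destruct (Rlt_dec (Cmod z) 1) as [Hz|Hz].
    2:{ exists 0%C; intros H; contradiction. }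
    assert (H : ex_series (fun n => scal (pow_n z n) (a n) : C_CompleteNormedModule)).
    { apply ex_series_le with (fun n => Cmod z ^ n).
      - intros n.
        replace (pow_n z n) with (z ^ n)%C.
        2:{ induction n as [|n IH]; [reflexivity|]. simpl; rewrite IH; reflexivity. }
        change (Cmod (z ^ n * a n) <= Cmod z ^ n).
        rewrite Cmod_mult, Cmod_pow.
        assert (H := Ha n). assert (H' := pow_le (Cmod z) n (Cmod_ge_0 z)). nra.
      - apply ex_series_geom. rewrite Rabs_pos_eq; [exact Hz|apply Cmod_ge_0]. }
    destruct H as [v Hv]. exists v; intros _; exact Hv. }
  apply functional_choice in Hex; destruct Hex as [f Hf].
  exists f; split; [exact Hf|].
  intros z N Hz. specialize (Hf z Hz).
  apply le_epsilon; intros eps Heps.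
  assert (HB : locally (f z) (fun y : C => Cmod (y - f z) < eps)).
  { exact (locally_ball_norm (f z) (mkposreal eps Heps)). }
  destruct (Hf _ HB) as [m Hm].
  specialize (Hm (N + m)%nat ltac:(lia)). rewrite sum_n_peval in Hm.
  rewrite <- Nat.add_succ_r in Hm.
  assert (HT := peval_trunc_tail a N (S m) z Ha Hz).
  rewrite Cmod_sub_sym in Hm.
  replace (f z - peval (trunc a N) z)%C with
    (f z - peval (trunc a (N + S m)) z
     + (peval (trunc a (N + S m)) z - peval (trunc a N) z))%C by ring.
  eapply Rle_trans; [apply Cmod_triangle|].
  enough ((Cmod z ^ N - Cmod z ^ (N + S m)) / (1 - Cmod z)
          <= Cmod z ^ N / (1 - Cmod z)) by lra.
  apply Rmult_le_compat_r.
  - left; apply Rinv_0_lt_compat; lra.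
  - assert (H := pow_le (Cmod z) (N + S m) (Cmod_ge_0 z)). lra.
Qed.

(** * Minimum on a circle, upper limit at 1 *)

(** [f] is a uniform limit of polynomials on the circle; a truncation within
    [eps / 4] of [f] is Lipschitz. *)
Lemma continuous_on_circle (a : nat -> C) (f : C -> C) (r : R) :
  (forall z N, Cmod z < 1 ->
     Cmod (f z - peval (trunc a N) z) <= Cmod z ^ N / (1 - Cmod z)) ->
  0 < r < 1 ->
  forall eps, 0 < eps -> exists delta, 0 < delta /\
    forall z w, Cmod z = r -> Cmod w = r -> Cmod (z - w) < delta ->
      Rabs (Cmod (f z) - Cmod (f w)) < eps.
Proof.
  intros Hf Hr eps Heps.
  destruct (pow_lt_1_zero r ltac:(rewrite Rabs_pos_eq; lra) (eps / 4 * (1 - r)))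
    as [N HN]; [apply Rmult_lt_0_compat; lra|].
  specialize (HN N ltac:(lia)). rewrite Rabs_pos_eq in HN by (apply pow_le; lra).
  assert (HN' : r ^ N / (1 - r) < eps / 4).
  { apply Rmult_lt_reg_r with (1 - r); [lra|].
    unfold Rdiv at 1. rewrite Rmult_assoc, Rinv_l by lra. lra. }
  set (L := lip_const (trunc a N)).
  assert (HL : 0 <= L) by apply lip_const_ge0.
  exists (eps / 4 / (L + 1)); split.
  { apply Rdiv_lt_0_compat; lra. }
  intros z w Hz Hw Hd.
  assert (Hfz := Hf z N). assert (Hfw := Hf w N).
  rewrite Hz in Hfz; rewrite Hw in Hfw.
  specialize (Hfz ltac:(lra)); specialize (Hfw ltac:(lra)).
  assert (Hp : Cmod (peval (trunc a N) z - peval (trunc a N) w) <= L * Cmod (z - w)).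
  { apply peval_lipschitz; [rewrite Hz|rewrite Hw]; lra. }
  assert (Hd' : L * Cmod (z - w) <= eps / 4).
  { apply Rle_trans with (L * (eps / 4 / (L + 1))).
    - apply Rmult_le_compat_l; lra.
    - apply Rmult_le_reg_r with (L + 1); [lra|].
      replace (L * (eps / 4 / (L + 1)) * (L + 1)) with (L * (eps / 4)) by (field; lra).
      nra. }
  assert (Hzw : Cmod (f z - f w) < eps).
  { replace (f z - f w)%C with
      ((f z - peval (trunc a N) z) + (peval (trunc a N) z - peval (trunc a N) w)
       + - (f w - peval (trunc a N) w))%C by ring.
    eapply Rle_lt_trans; [apply Cmod_triangle|].
    eapply Rle_lt_trans; [apply Rplus_le_compat_r, Cmod_triangle|].
    rewrite Cmod_opp. lra. }
  assert (H1 := Cmod_ge_sub (f z) (f w)).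
  assert (H2 := Cmod_ge_sub (f w) (f z)).
  rewrite Cmod_sub_sym in H2.
  apply Rabs_def1; lra.
Qed.

Lemma polar (z : C) (r : R) :
  0 < r -> Cmod z = r ->
  exists t, - PI <= t <= PI /\ z = (r * cos t, r * sin t).
Proof.
  intros Hr Hz. destruct z as [x y].
  assert (Hxy : x ^ 2 + y ^ 2 = r ^ 2).
  { rewrite <- Hz. rewrite Cmod2_alt. reflexivity. }
  assert (Hx : -1 <= x / r <= 1).
  { split; apply Rmult_le_reg_r with r; try lra;
      unfold Rdiv; rewrite Rmult_assoc, Rinv_l by lra; nra. }
  assert (Hs : r * sqrt (1 - (x / r)²) = Rabs y).
  { rewrite <- (sqrt_Rsqr_abs y).
    replace y² with (r² * (1 - (x / r)²)).
    2:{ transitivity (r ^ 2 - x ^ 2); [|unfold Rsqr; lra].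
        unfold Rsqr; field; lra. }
    rewrite sqrt_mult_alt by apply Rle_0_sqr.
    rewrite sqrt_Rsqr by lra. reflexivity. }
  assert (Hb := acos_bound (x / r)).
  destruct (Rle_lt_dec 0 y) as [Hy|Hy].
  - exists (acos (x / r)); split; [lra|].
    rewrite cos_acos, sin_acos, Hs, Rabs_pos_eq by assumption.
    f_equal; field; lra.
  - exists (- acos (x / r)); split; [lra|].
    rewrite cos_neg, sin_neg, cos_acos, sin_acos by assumption.
    rewrite Ropp_mult_distr_r_reverse, Hs, Rabs_left by assumption.
    f_equal; [field|]; lra.
Qed.

Lemma Cmod_le_abs (x y : R) : Cmod (x, y) <= Rabs x + Rabs y.
Proof.
  replace ((x, y) : C) with (RtoC x + RtoC y * Ci)%C.
  2:{ unfold RtoC, Ci, Cplus, Cmult; simpl; f_equal; ring. }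
  eapply Rle_trans; [apply Cmod_triangle|].
  rewrite Cmod_mult, Cmod_Ci, !Cmod_R. lra.
Qed.

(** The circle is the image of [[-PI, PI]] under [t -> r e^{it}], which reduces
    the claim to the extreme value theorem on a segment. *)
Lemma min_on_circle_exists (h : C -> R) (r : R) :
  0 < r ->
  (forall eps, 0 < eps -> exists delta, 0 < delta /\
    forall z w, Cmod z = r -> Cmod w = r -> Cmod (z - w) < delta ->
      Rabs (h z - h w) < eps) ->
  exists m, is_min_on (fun z => Cmod z = r) h m.
Proof.
  intros Hr Hh.
  set (g := fun t => ((r * cos t, r * sin t) : C)).
  assert (Hg : forall t, Cmod (g t) = r).
  { intros t. unfold Cmod, g; simpl fst; simpl snd.
    replace ((r * cos t) ^ 2 + (r * sin t) ^ 2) with (r²).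
    - apply sqrt_Rsqr; lra.
    - assert (H := sin2_cos2 t). unfold Rsqr in *. nra. }
  destruct (continuity_ab_min (fun t => h (g t)) (- PI) PI) as [t0 [Hmin _]].
  - assert (H := PI_RGT_0); lra.
  - intros c _ eps Heps.
    destruct (Hh eps Heps) as [delta [Hd Hdelta]].
    assert (Hd' : 0 < delta / (2 * r)) by (apply Rdiv_lt_0_compat; lra).
    destruct (continuity_cos c _ Hd') as [d1 [Hd1 H1]].
    destruct (continuity_sin c _ Hd') as [d2 [Hd2 H2]].
    exists (Rmin d1 d2); split; [apply Rmin_pos; assumption|].
    intros x [Hx Hxc]. change (Rabs (x - c) < Rmin d1 d2) in Hxc.
    change (Rabs (h (g x) - h (g c)) < eps).
    apply Hdelta; [apply Hg|apply Hg|].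
    assert (M1 := Rmin_l d1 d2). assert (M2 := Rmin_r d1 d2).
    assert (Hcos : Rabs (cos x - cos c) < delta / (2 * r)).
    { apply H1; split; [exact Hx|]. change (Rabs (x - c) < d1). lra. }
    assert (Hsin : Rabs (sin x - sin c) < delta / (2 * r)).
    { apply H2; split; [exact Hx|]. change (Rabs (x - c) < d2). lra. }
    replace (g x - g c)%C with ((r * (cos x - cos c), r * (sin x - sin c)) : C).
    2:{ unfold g, Cminus, Cplus, Copp; simpl; f_equal; ring. }
    eapply Rle_lt_trans; [apply Cmod_le_abs|].
    rewrite !Rabs_mult, (Rabs_pos_eq r) by lra.
    replace delta with (r * (delta / (2 * r)) + r * (delta / (2 * r))) by (field; lra).
    apply Rplus_lt_compat; apply Rmult_lt_compat_l; assumption.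
  - exists (h (g t0)); split.
    + exists (g t0); split; [apply Hg|reflexivity].
    + intros z Hz. destruct (polar z r Hr Hz) as [t [Ht ->]].
      apply (Hmin t Ht).
Qed.

(** The radii [r k] enter every left neighbourhood of 1, so the supremum over each
    of them is infinite, and so is the infimum of these suprema. *)
Lemma LimSup_at_left_1_infty (m : R -> R) (r : nat -> R) :
  (forall k, 1 - / (INR k + 1) < r k < 1) ->
  (forall k, INR k <= m (r k)) ->
  LimSup (at_left 1) m = p_infty.
Proof.
  intros Hr Hm.
  apply Rbar_is_glb_unique. split.
  2:{ intros b _; destruct b; exact I. }
  intros s [P [HP ->]].
  rewrite (is_lub_Rbar_unique _ p_infty); [exact I|].
  split; [intros y _; exact I|].
  intros b Hb. destruct b as [b| |]; [exfalso|exact I|exfalso].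
  2:{ destruct HP as [d Hd].
      specialize (Hd (1 - d / 2)).
      assert (Hdp := cond_pos d).
      apply (Hb (m (1 - d / 2))). exists (1 - d / 2); split; [|reflexivity].
      apply Hd; [|lra].
      change (Rabs (1 - d / 2 - 1) < d).
      replace (1 - d / 2 - 1) with (- (d / 2)) by ring.
      rewrite Rabs_Ropp, Rabs_pos_eq; lra. }
  destruct HP as [d Hd].
  assert (Hdp := cond_pos d).
  destruct (archimed_cor1 d Hdp) as [k1 [Hk1 Hk1']].
  assert (Hk2 : exists k2 : nat, b < INR k2).
  { destruct (INR_unbounded b) as [n Hn]. exists n; lra. }
  destruct Hk2 as [k2 Hk2].
  set (k := max k1 k2).
  assert (I1 : INR k1 <= INR k) by (apply le_INR; unfold k; lia).
  assert (I2 : INR k2 <= INR k) by (apply le_INR; unfold k; lia).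
  assert (I0 : 0 < INR k1) by (apply lt_0_INR; exact Hk1').
  assert (Hinv : / (INR k + 1) < d).
  { apply Rle_lt_trans with (/ INR k1); [|exact Hk1].
    apply Rinv_le_contravar; lra. }
  specialize (Hr k); specialize (Hm k).
  assert (H : Rbar_le (m (r k)) b).
  { apply Hb. exists (r k); split; [|reflexivity].
    apply Hd; [|lra].
    change (Rabs (r k - 1) < d). apply Rabs_def1; lra. }
  simpl in H. lra.
Qed.

(** * Doubling the coefficients *)

(** The coefficients of [(2 + z) g(z^2)] when [g] has coefficients [b].  The factor
    [2 + z] has no zero in the closed disc, where its modulus is at least 1, and
    it puts comparable coefficients at the places [2 n] and [2 n + 1]. *)
Definition interleave (b : nat -> C) (n : nat) : C :=
  if Nat.even n then (2 * b (Nat.div2 n))%C else b (Nat.div2 n).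

Lemma interleave_even (b : nat -> C) (n : nat) :
  interleave b (2 * n) = (2 * b n)%C.
Proof. unfold interleave. rewrite Nat.even_even, Nat.div2_even; reflexivity. Qed.

Lemma interleave_odd (b : nat -> C) (n : nat) :
  interleave b (2 * n + 1) = b n.
Proof. unfold interleave. rewrite Nat.even_odd, Nat.div2_odd'; reflexivity. Qed.

Lemma trunc_interleave_S (b : nat -> C) (N : nat) :
  trunc (interleave b) (2 * S N) = trunc (interleave b) (2 * N) ++ [(2 * b N)%C; b N].
Proof.
  replace (2 * S N)%nat with (S (S (2 * N))) by lia.
  rewrite !trunc_S, interleave_even, <- app_assoc.
  rewrite <- (Nat.add_1_r (2 * N)), interleave_odd. reflexivity.
Qed.

Lemma peval_interleave (b : nat -> C) (N : nat) (z : C) :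
  peval (trunc (interleave b) (2 * N)) z
  = ((2 + z) * peval (trunc b N) (z ^ 2))%C.
Proof.
  induction N as [|N IH].
  - simpl; ring.
  - rewrite trunc_interleave_S, peval_app, IH, length_trunc, peval_trunc_S.
    rewrite Cpow_mult_r. cbn [peval]. ring.
Qed.

Lemma ex_series_pos (u : nat -> R) (B : R) :
  (forall n, 0 <= u n) -> (forall n, sum_n u n <= B) -> ex_series u.
Proof.
  intros Hu HB.
  destruct (ex_finite_lim_seq_incr (sum_n u) B) as [s Hs]; [|exact HB|].
  - intros n. rewrite sum_Sn. unfold plus; simpl. specialize (Hu (S n)); lra.
  - exists s; exact Hs.
Qed.

Lemma sum_n_lsum (h : C -> R) (a : nat -> C) (N : nat) :
  sum_n (fun n => h (a n)) N = lsum h (trunc a (S N)).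
Proof.
  induction N as [|N IH].
  - rewrite sum_O. simpl; lra.
  - rewrite sum_Sn, IH, (trunc_S a (S N)), lsum_app.
    cbn [lsum fold_right]. rewrite Rplus_0_r. reflexivity.
Qed.

Lemma lsum_trunc_mono (h : C -> R) (a : nat -> C) (N M : nat) :
  (forall x, 0 <= h x) -> (N <= M)%nat -> lsum h (trunc a N) <= lsum h (trunc a M).
Proof.
  intros Hh; induction 1 as [|M _ IH]; [lra|].
  rewrite trunc_S, lsum_app. simpl. specialize (Hh (a M)); lra.
Qed.

Lemma lsum_interleave_le (h : C -> R) (b : nat -> C) (N : nat) :
  (forall x, h x <= h (2 * x)%C) ->
  lsum h (trunc (interleave b) (2 * N)) <= 2 * lsum (fun x => h (2 * x)%C) (trunc b N).
Proof.
  intros Hh; induction N as [|N IH]; [simpl; lra|].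
  rewrite trunc_interleave_S, trunc_S, !lsum_app.
  specialize (Hh (b N)). cbn [lsum fold_right]. unfold lsum in *; cbn [fold_right].
  lra.
Qed.

Lemma Rmin_interleave (b : nat -> C) (k : nat) :
  Rmin (Cmod (interleave b (2 * k)) ^ 2) (Cmod (interleave b (2 * k + 1)) ^ 2)
  = Cmod (b k) ^ 2.
Proof.
  rewrite interleave_even, interleave_odd, Cmod_mult, Cmod_R, Rabs_pos_eq by lra.
  apply Rmin_right. assert (H := Cmod_ge_0 (b k)). nra.
Qed.

(** * The construction *)

(** The properties of [next_block] survive in the limit because each step only
    appends.  The weighted sums of the blocks are at most [2^-k] and add up to at
    most 2; each block adds at least 1 to the sum of squares. *)
Lemma block_sequence (phi : R -> R)
  (phi_incr : forall x y : R, 0 < x -> x <= y -> phi x <= phi y)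
  (phi_lim : is_lim phi p_infty p_infty) :
  exists (b : nat -> C) (N : nat -> nat) (r : nat -> R),
    (forall n, Cmod (b n) <= 1 / 2) /\
    (forall k,
      (k <= N k)%nat /\
      lsum (fun x => ell2_phi_term phi (2 * x)) (trunc b (N k)) <= 2 /\
      INR k <= lsum (fun x => Cmod x ^ 2) (trunc b (N k)) /\
      1 - / (INR k + 1) < r k < 1 /\
      (forall w, Cmod w = r k ^ 2 ->
         INR k + 1 <= Cmod (peval (trunc b (N (S k))) w)) /\
      r k ^ (2 * N (S k)) <= 1 - r k).
Proof.
  assert (Hstep : forall lk : list C * nat, exists tr : list C * R,
    (forall x, In x (fst tr) -> Cmod x <= 1 / 2) /\
    lsum (fun x => ell2_phi_term phi (2 * x)) (fst tr) <= (1 / 2) ^ snd lk /\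
    1 <= lsum (fun x => Cmod x ^ 2) (fst tr) /\
    1 - / (INR (snd lk) + 1) < snd tr < 1 /\
    (forall w, Cmod w = snd tr ^ 2 ->
       INR (snd lk) + 1 <= Cmod (peval (fst lk ++ fst tr) w)) /\
    snd tr ^ (2 * length (fst lk ++ fst tr)) <= 1 - snd tr).
  { intros [l k].
    destruct (next_block phi phi_incr phi_lim l k) as [t [r H]].
    exists (t, r); exact H. }
  apply functional_choice in Hstep; destruct Hstep as [step Hstep].
  set (L := nat_rect (fun _ => list C) nil (fun k l => l ++ fst (step (l, k)))).
  assert (LS : forall k, L (S k) = L k ++ fst (step (L k, k))) by reflexivity.
  destruct (prefix_limit L) as [b Hb].
  { intros k. exists (fst (step (L k, k))); split; [|apply LS].
    intros E. destruct (Hstep (L k, k)) as [_ [_ [H _]]].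
    rewrite E in H; simpl in H; lra. }
  exists b, (fun k => length (L k)), (fun k => snd (step (L k, k))).
  assert (Hb' : forall k, trunc b (length (L k)) = L k) by (intros k; apply Hb).
  assert (Hsmall : forall k x, In x (L k) -> Cmod x <= 1 / 2).
  { induction k as [|k IH]; [intros x []|].
    intros x Hx. rewrite LS in Hx. apply in_app_or in Hx; destruct Hx as [Hx|Hx].
    - apply IH, Hx.
    - destruct (Hstep (L k, k)) as [H _]. apply H, Hx. }
  split.
  - intros n. apply (Hsmall (S n)). rewrite <- Hb'.
    apply in_map, in_seq. destruct (Hb (S n)) as [H _]. lia.
  - intros k. rewrite !Hb'.
    destruct (Hstep (L k, k)) as [_ [_ [_ [H4 [H5 H6]]]]].
    split; [apply Hb|split; [|split; [|split; [exact H4|split]]]].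
    + enough (lsum (fun x => ell2_phi_term phi (2 * x)) (L k)
              <= 2 - 2 * (1 / 2) ^ k).
      { assert (0 < (1 / 2) ^ k) by (apply pow_lt; lra). lra. }
      clear H4 H5 H6. induction k as [|k IH]; [simpl; lra|].
      rewrite LS, lsum_app.
      destruct (Hstep (L k, k)) as [_ [H _]]. cbn [snd] in H. simpl pow. lra.
    + clear H4 H5 H6. induction k as [|k IH]; [simpl; lra|].
      rewrite LS, lsum_app, S_INR.
      destruct (Hstep (L k, k)) as [_ [_ [H _]]]. lra.
    + exact H5.
    + exact H6.
Qed.

Theorem theorem7 (phi : R -> R)
  (phi_incr : forall x y : R, 0 < x -> x <= y -> phi x <= phi y)
  (phi_pos : forall x : R, 0 < x -> 0 < phi x)
  (phi_lim : is_lim phi p_infty p_infty) :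
  exists (f : C -> C) (a : nat -> C),
    taylor_on_disc f a /\ strongly_annular f /\
    ell2_phi phi a /\ ~ ell2_tilde a.
Proof.
  destruct (block_sequence phi phi_incr phi_lim) as [b [N [r [Hb HN]]]].
  assert (Ha : forall n, Cmod (interleave b n) <= 1).
  { intros n. unfold interleave. specialize (Hb (Nat.div2 n)).
    destruct (Nat.even n); [|lra].
    rewrite Cmod_mult, Cmod_R, Rabs_pos_eq; lra. }
  destruct (taylor_bounded _ Ha) as [f [Hf Htail]].
  exists f, (interleave b). split; [exact Hf|split; [|split]].
  - assert (Hmin : forall s, exists m, 0 < s < 1 ->
      is_min_on (fun z => Cmod z = s) (fun z => Cmod (f z)) m).
    { intros s. destruct (Rlt_dec 0 s) as [H0|H0], (Rlt_dec s 1) as [H1|H1];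
        try (exists 0; intros; lra).
      destruct (min_on_circle_exists (fun z => Cmod (f z)) s H0) as [m Hm].
      - apply (continuous_on_circle (interleave b)); [exact Htail|lra].
      - exists m; intros _; exact Hm. }
    apply functional_choice in Hmin; destruct Hmin as [m Hm].
    exists m; split; [exact Hm|].
    apply (LimSup_at_left_1_infty m r); intros k;
      destruct (HN k) as [_ [_ [_ [Hr [Hlow Hsmall]]]]]; [exact Hr|].
    assert (Hr0 : 0 < r k).
    { enough (/ (INR k + 1) <= 1) by lra.
      rewrite <- Rinv_1 at 2. apply Rinv_le_contravar; [lra|].
      assert (H := pos_INR k); lra. }
    (* at a point of the circle where [|f|] is minimal, the truncation at
       [2 N (k+1)] is at least [k + 1] and the tail at most 1 *)
    destruct (Hm (r k) ltac:(lra)) as [[z [Hz <-]] _].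
    assert (Hz1 : Cmod z < 1) by (rewrite Hz; lra).
    assert (HT := Htail z (2 * N (S k))%nat Hz1).
    rewrite peval_interleave, Hz in HT.
    assert (HT1 : r k ^ (2 * N (S k)) / (1 - r k) <= 1).
    { apply Rmult_le_reg_r with (1 - r k); [lra|].
      unfold Rdiv; rewrite Rmult_assoc, Rinv_l; lra. }
    specialize (Hlow (z ^ 2)%C ltac:(rewrite Cmod_pow, Hz; reflexivity)).
    assert (H2 : 1 <= Cmod (2 + z)).
    { assert (H := Cmod_ge_sub (RtoC 2) (- z)).
      rewrite Cmod_opp, Cmod_R, Rabs_pos_eq in H by lra.
      replace (2 - - z)%C with (2 + z)%C in H by ring. lra. }
    set (p := peval (trunc b (N (S k))) (z ^ 2)) in *.
    assert (H4 := Cmod_ge_sub ((2 + z) * p) ((2 + z) * p - f z)).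
    replace ((2 + z) * p - ((2 + z) * p - f z))%C with (f z) in H4 by ring.
    rewrite (Cmod_sub_sym _ (f z)), Cmod_mult in H4.
    assert (Hp := Cmod_ge_0 p). nra.
  - assert (Hpos : forall c, 0 <= ell2_phi_term phi c).
    { intros c; apply ell2_phi_term_ge0, phi_pos. }
    apply (ex_series_pos _ 4); [intros n; apply Hpos|].
    intros n. rewrite (sum_n_lsum (ell2_phi_term phi)).
    destruct (HN (S n)) as [HNn [Hsum _]].
    apply Rle_trans
      with (lsum (ell2_phi_term phi) (trunc (interleave b) (2 * N (S n)))).
    { apply lsum_trunc_mono; [exact Hpos|lia]. }
    eapply Rle_trans; [apply lsum_interleave_le|lra].
    intros x. apply ell2_phi_term_mono; [exact phi_incr|exact phi_pos|].
    rewrite Cmod_mult, Cmod_R, Rabs_pos_eq by lra.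
    assert (H := Cmod_ge_0 x); lra.
  - intros Ht. unfold ell2_tilde in Ht.
    apply (ex_series_ext _ (fun k => Cmod (b k) ^ 2)) in Ht.
    2:{ intros k; apply Rmin_interleave. }
    destruct Ht as [s Hs].
    assert (Hle : forall n, sum_n (fun k => Cmod (b k) ^ 2) n <= s).
    { intros n.
      apply (is_lim_seq_incr_compare (sum_n (fun k => Cmod (b k) ^ 2)) s); [exact Hs|].
      intros j. rewrite sum_Sn. change plus with Rplus.
      assert (H := pow2_ge_0 (Cmod (b (S j)))). lra. }
    destruct (INR_unbounded s) as [k Hk].
    destruct (HN k) as [_ [_ [Hsq _]]].
    specialize (Hle (N k)). rewrite (sum_n_lsum (fun x => Cmod x ^ 2)) in Hle.
    assert (H := lsum_trunc_mono (fun x => Cmod x ^ 2) b (N k) (S (N k))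
      (fun x => pow2_ge_0 _) ltac:(lia)).
    lra.
Qed.
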